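(* Let $A$ be a finite alphabet and let $S\subseteq A^*$ be a uniformly recurrent tree set containing $A$. Then $S$ has the finite index basis property: for every finite bifix code $X\subseteq S$ and every integer $d\ge 1$, the set $X$ is an $S$-maximal bifix code of $S$-degree $d$ if and only if $X$ is a basis of a subgroup of index $d$ of the free group $F_A$ on $A$.
   Context: Words are elements of the free monoid $A^*$; $1$ (or $\varepsilon$) is the empty word. A set $S$ of words is factorial if it contains all factors of its elements. For $w\in S$ let $L(w)=\{a\in A: aw\in S\}$, $R(w)=\{a\in A: wa\in S\}$, $E(w)=\{(a,b)\in A\times A: awb\in S\}$. $S$ is biextendable if it is factorial and $E(w)\neq\emptyset$ for every $w\in S$. $S$ is uniformly recurrent if it is factorial, every $w\in S$ has $R(w)\ne\emptyset$, and for every $u\in S$ there is $n\ge1$ such that $u$ is a factor of every word of $S$ of length $n$. The extension graph $G(w)$ of $w\in S$ is the undirected bipartite graph whose vertex set is the disjoint union of a copy of $L(w)$ and a copy of $R(w)$, with an edge between $a\in L(w)$ and $b\in R(w)$ iff $(a,b)\in E(w)$. $S$ is a tree set if it is biextendable and $G(w)$ is a tree (connected and acyclic) for every $w\in S$. A prefix code is a set of nonempty words none of which is a proper prefix of another; suffix codes are defined symmetrically; a bifix code is both. A bifix code $X\subseteq S$ is $S$-maximal if it is not properly contained in any bifix code $Y\subseteq S$. A parse of a word $w$ with respect to $X$ is a triple $(v,x,u)$ with $w=vxu$, $v$ has no suffix in $X$, $u$ has no prefix in $X$, and $x\in X^*$. The $S$-degree of $X$ is the maximal number of parses of a word of $S$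 with respect to $X$. *)

(* Defs.v *)
From HB Require Import structures.
From mathcomp Require Import all_boot.
From mathcomp Require Import boolp classical_sets functions cardinality.

Set Implicit Arguments.
Unset Strict Implicit.
Unset Printing Implicit Defensive.

Local Open Scope classical_set_scope.
Local Open Scope card_scope.

(* The letter (a, true) stands for the generator a, and (a, false) for its
   formal inverse. *)
Section FreeGroup.
Variable T : choiceType.

Implicit Types (l : T * bool) (s t w : seq (T * bool)).

Definition fg_invl l : T * bool := (l.1, ~~ l.2).

Definition fg_reduced w : bool := sorted (fun l m => m != fg_invl l) w.

Definition fg_cons l w : seq (T * bool) :=
  if w is m :: w' then if m == fg_invl l then w' else l :: w else [:: l].

Definition fg_reduce w : seq (T * bool) := foldr fg_cons [::] w.

Record freeGroup := FreeGroup { fg_word :> seq (T * bool); _ : fg_reduced fg_word }.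

HB.instance Definition _ := [isSub for fg_word].
HB.instance Definition _ := [Choice of freeGroup by <:].

Lemma fg_invlK : involutive fg_invl.
Proof. by case=> a b; rewrite /fg_invl /= negbK. Qed.

Lemma fg_cons_reduced l w : fg_reduced w -> fg_reduced (fg_cons l w).
Proof.
case: w => [|m w] //= red_w; case: ifPn => [_|neq]; last by rewrite /= neq.
exact: path_sorted red_w.
Qed.

Lemma fg_reduce_reduced w : fg_reduced (fg_reduce w).
Proof. by elim: w => //= l w; apply: fg_cons_reduced. Qed.

Lemma fg_reduce_id w : fg_reduced w -> fg_reduce w = w.
Proof.
elim: w => //= l w IHw red_w; rewrite IHw; last exact: path_sorted red_w.
by case: w red_w {IHw} => //= m w /andP[/negPf-> _].
Qed.

Lemma fg_consK l w : fg_reduced w -> fg_cons l (fg_cons (fg_invl l) w) = w.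
Proof.
case: w => [|m w] /=; first by rewrite eqxx.
rewrite fg_invlK; case: (m =P l) => [->|_ _] /=; last by rewrite eqxx.
by case: w => //= n w /andP[/negPf-> _].
Qed.

Lemma fg_reduce_cat s t :
  fg_reduce (s ++ t) = foldr fg_cons (fg_reduce t) s.
Proof. by rewrite /fg_reduce foldr_cat. Qed.

Lemma fg_foldr_cons l s t : fg_reduced t ->
  foldr fg_cons t (fg_cons l s) = fg_cons l (foldr fg_cons t s).
Proof.
move=> red_t; case: s => [|m s] //=; case: eqP => //= ->; rewrite fg_consK //.
by elim: s => //= n s; apply: fg_cons_reduced.
Qed.

Lemma fg_reduce_catl s t : fg_reduce (fg_reduce s ++ t) = fg_reduce (s ++ t).
Proof.
rewrite !fg_reduce_cat; elim: s => //= l s IHs.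
by rewrite fg_foldr_cons ?IHs ?fg_reduce_reduced.
Qed.

Lemma fg_reduce_catr s t : fg_reduce (s ++ fg_reduce t) = fg_reduce (s ++ t).
Proof. by rewrite !fg_reduce_cat (fg_reduce_id (fg_reduce_reduced t)). Qed.

Definition fg_invw w : seq (T * bool) := rev (map fg_invl w).

Lemma fg_reduce_mulwV w : fg_reduce (w ++ fg_invw w) = [::].
Proof.
elim: w => //= l w IHw; rewrite /fg_invw /= rev_cons -cats1 catA.
by rewrite -/(fg_invw w) -fg_reduce_catl IHw /= eqxx.
Qed.

Lemma fg_invwK : involutive fg_invw.
Proof. by move=> w; rewrite /fg_invw map_rev revK mapK //; apply: fg_invlK. Qed.

Definition fg_one : freeGroup := @FreeGroup [::] isT.
Definition fg_mul (x y : freeGroup) : freeGroup :=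
  FreeGroup (fg_reduce_reduced (x ++ y)).
Definition fg_inv (x : freeGroup) : freeGroup :=
  FreeGroup (fg_reduce_reduced (fg_invw x)).

Lemma fg_mulA : associative fg_mul.
Proof.
by move=> x y z; apply: val_inj; rewrite /= fg_reduce_catl fg_reduce_catr catA.
Qed.

Lemma fg_mul1 : left_id fg_one fg_mul.
Proof. by case=> w red_w; apply: val_inj; rewrite /= fg_reduce_id. Qed.

Lemma fg_mulr1 : right_id fg_one fg_mul.
Proof. by case=> w red_w; apply: val_inj; rewrite /= cats0 fg_reduce_id. Qed.

Lemma fg_mulV : left_inverse fg_one fg_inv fg_mul.
Proof.
move=> x; apply: val_inj => /=; rewrite fg_reduce_catl.
by rewrite -{2}(fg_invwK x) fg_reduce_mulwV.
Qed.

Lemma fg_mulrV : right_inverse fg_one fg_inv fg_mul.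
Proof.
by move=> x; apply: val_inj => /=; rewrite fg_reduce_catr fg_reduce_mulwV.
Qed.

HB.instance Definition _ :=
  isGroup.Build freeGroup fg_mulA fg_mul1 fg_mulr1 fg_mulV fg_mulrV.

Definition fg_gen (a : T) : freeGroup := @FreeGroup [:: (a, true)] isT.

End FreeGroup.

(* The canonical morphism A^* -> F_A. *)
Definition fg_of_word (T : choiceType) (w : seq T) : freeGroup T :=
  (\prod_(a <- w) fg_gen a)%g.

(* The morphism F_T -> G extending f : T -> G. *)
Definition fg_lift (T : choiceType) (G : groupType) (f : T -> G)
    (x : freeGroup T) : G :=
  (\prod_(l <- fg_word x) if l.2 then f l.1 else (f l.1)^-1)%g.

Lemma fg_lift_gen (T : choiceType) (G : groupType) (f : T -> G) (a : T) :
  fg_lift f (fg_gen a) = f a.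
Proof. by rewrite /fg_lift /= big_seq1. Qed.

Lemma fg_liftM (T : choiceType) (G : groupType) (f : T -> G) :
  {morph fg_lift f : x y / (x * y)%g}.
Proof.
move=> x y; rewrite /fg_lift -big_cat /=; elim: (_ ++ _) => //= l s IHs.
rewrite big_cons -IHs.
case: (fg_reduce s) => [|m w] /=; first by rewrite !big_cons.
case: eqP => [->|_]; last by rewrite big_cons.
rewrite big_cons mulgA /=; case: (l.2); first by rewrite mulgV mul1g.
by rewrite mulVg mul1g.
Qed.

Section Subgroups.
Variable G : groupType.
Implicit Types (H B : set G).

Definition is_subgroup H : Prop := group_closed [pred x | x \in H].

Definition right_cosets H : set (set G) :=
  [set [set (h * g)%g | h in H] | g in [set: G]].

Definition has_index H (d : nat) : Prop := right_cosets H #= `I_d.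

(* The morphism from the free group on B to G induced by the inclusion of B in
   G is an isomorphism onto H. *)
Definition is_basis H B : Prop :=
  let phi := fg_lift (fun b : B => val b) in
  injective phi /\ range phi = H.

End Subgroups.

(* A finite undirected graph is given by its set V of vertices and a symmetric,
   irreflexive adjacency relation e that only relates elements of V. *)
Definition graph_connected (T : finType) (V : set T) (e : rel T) : Prop :=
  forall x y, V x -> V y -> connect e x y.

Definition graph_acyclic (T : finType) (e : rel T) : Prop :=
  forall c : seq T, 2 < size c -> ~ ucycle e c.

Definition is_tree (T : finType) (V : set T) (e : rel T) : Prop :=
  graph_connected V e /\ graph_acyclic e.

Section Words.
Variable A : finType.
Implicit Types (S X Y : set (seq A)) (u v w x : seq A).

Definition factorial_set S : Prop := forall u w, S w -> infix u w -> S u.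

Definition lext S w : set A := [set a | S (a :: w)].
Definition rext S w : set A := [set b | S (rcons w b)].
Definition biext S w : set (A * A) := [set ab | S (ab.1 :: rcons w ab.2)].

Definition biextendable S : Prop :=
  factorial_set S /\ forall w, S w -> biext S w !=set0.

Definition uniformly_recurrent S : Prop :=
  [/\ factorial_set S,
      forall w, S w -> rext S w !=set0 &
      forall u, S u -> exists2 n, 1 <= n &
        forall w, S w -> size w = n -> infix u w].

Definition ext_vertices S w : set (A + A) :=
  [set inl a | a in lext S w] `|` [set inr b | b in rext S w].

Definition ext_edge S w : rel (A + A) := fun p q =>
  match p, q with
  | inl a, inr b | inr b, inl a =>
      `[< [/\ lext S w a, rext S w b & biext S w (a, b)] >]
  | _, _ => false
  end.

Definition tree_set S : Prop :=
  biextendable S /\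
  forall w, S w -> is_tree (ext_vertices S w) (ext_edge S w).

Definition prefix_code X : Prop :=
  ~ X [::] /\ forall x y, X x -> X y -> prefix x y -> x = y.

Definition suffix_code X : Prop :=
  ~ X [::] /\ forall x y, X x -> X y -> suffix x y -> x = y.

Definition bifix_code X : Prop := prefix_code X /\ suffix_code X.

Definition maximal_bifix_code S X : Prop :=
  [/\ bifix_code X, X `<=` S &
      forall Y, bifix_code Y -> Y `<=` S -> X `<=` Y -> Y = X].

Definition word_star X : set (seq A) :=
  [set w | exists2 xs : seq (seq A), (forall x, x \in xs -> X x) & w = flatten xs].

Definition parses X w : set (seq A * seq A * seq A) :=
  [set p | let: (v, x, u) := p in
     [/\ w = v ++ x ++ u,
         ~ (exists2 y, X y & suffix y v),
         ~ (exists2 y, X y & prefix y u) &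
         word_star X x]].

Definition has_degree S X (d : nat) : Prop :=
  (exists2 w, S w & parses X w #= `I_d) /\
  (forall w, S w -> parses X w #<= `I_d).

End Words.

(* Main.v *)
(* The key tool is that a cocycle on the Rauzy graphs of an acyclic set [S],
   with values in any group, is cohomologous to one that only depends on the
   letter labelling an edge: on a forest [G(w)] every labelling [f(a, b)] of the
   edges is of the form [alpha(a) beta(b)], which lowers the length of the
   contexts by one. Let [G] be the free group on the bifix code [X]. Reading a
   word [v] greedily along [X] leads from [(1, k)] to a state [(p, k x_1 ... x_r)]
   of [A^* x G], where [v = x_1 ... x_r p]. In every context, reading a letter is
   a partial injection because [X] is a suffix code, so it extends to a
   permutation-valued cocycle. The coboundaries met in the descent fix the
   states [(1, k)], so the outcome is an action of [F_A] on [A^* x G] in which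
   [x] in [X] sends [(1, k)] to [(1, k x)]. Hence [X] is free and [<X>] meets [S] in [X^*].

   The parses of [w] correspond to the suffixes of [w] without prefix in [X],
   and by the previous point these lie in distinct right cosets of [<X>].
   If long words have exactly [d] parses, the union of the cosets
   attached to a long word [u] is mapped by a letter [b] onto the union attached
   to [ub]; connectedness of the extension graphs makes it independent of [u],
   hence invariant under [F_A], so that the [d] cosets exhaust [F_A].
   Conversely, index [d] bounds the number of parses, and uniform recurrence
   then forces every long word to have a prefix in [X]. *)
From HB Require Import structures.
Require Import Defs.
From mathcomp Require Import all_boot.
From mathcomp Require Import boolp classical_sets functions cardinality.
Set Implicit Arguments.
Unset Strict Implicit.
Unset Printing Implicit Defensive.
Local Open Scope classical_set_scope.
Local Open Scope card_scope.
Local Open Scope group_scope.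

(** * Suffixes, prefixes and counting in words *)

Lemma suffix_total (T : eqType) (p q u : seq T) :
  suffix p u -> suffix q u -> size p <= size q -> suffix p q.
Proof.
case/suffixP=> y ->; case/suffixP=> z yz le_pq.
have le_zy : size z <= size y.
  by rewrite -(leq_add2r (size q)) -size_cat -yz size_cat leq_add2l.
have /esym := congr1 (drop (size z)) yz; rewrite drop_size_cat // => ->.
rewrite drop_cat; case: ltnP => [_|_]; first exact: suffix_suffix.
by move: le_zy; rewrite -subn_eq0 => /eqP->; rewrite drop0 suffix_refl.
Qed.

Lemma suffix_code_uniq (A : finType) (X : set (seq A)) x y u :
  suffix_code X -> X x -> X y -> suffix x u -> suffix y u -> x = y.
Proof.
move=> [_ X_suff] Xx Xy xu yu; case/orP: (leq_total (size x) (size y)) => le.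
  exact: X_suff (suffix_total xu yu le).
by apply/esym; apply: X_suff (suffix_total yu xu le).
Qed.

Lemma suffix_consE (T : eqType) (p w : seq T) a :
  suffix p (a :: w) = (p == a :: w) || suffix p w.
Proof.
apply/idP/idP => [/suffixP[[|c y] /=]|/predU1P[->|pw]].
- by move=> ->; rewrite eqxx.
- by move=> [_ ->]; rewrite suffix_suffix orbT.
- exact: suffix_refl.
- exact: suffix_trans pw (suffix_cons _ _).
Qed.

Lemma catsI (T : eqType) (z : seq T) : injective (cat z).
Proof. by move=> v w /eqP; rewrite eqseq_cat // eqxx => /eqP. Qed.

Lemma catIs (T : eqType) (z : seq T) : injective (cat^~ z).
Proof. by move=> v w /(congr1 rev); rewrite !rev_cat => /catsI /(can_inj revK). Qed.

Lemma prefix_rconsE (T : eqType) (p w : seq T) b :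
  prefix p (rcons w b) = (p == rcons w b) || prefix p w.
Proof.
rewrite -suffix_rev rev_rcons suffix_consE suffix_rev -rev_rcons.
by rewrite (inj_eq (can_inj revK)).
Qed.

Lemma card_uniq_seq (T : eqType) (s : seq T) : uniq s -> [set` s] #= `I_(size s).
Proof.
case: s => [|x s] us; first by rewrite set_nil II0.
have -> : [set` x :: s] = nth x (x :: s) @` `I_(size (x :: s)).
  apply/seteqP; split=> [y /= ys|_ [i /= lt_i <-]]; last exact: mem_nth.
  by exists (index y (x :: s)); [rewrite -index_mem in ys|rewrite nth_index].
apply: inj_card_eq => i j /set_mem /= lt_i /set_mem /= lt_j /eqP.
by rewrite nth_uniq // => /eqP.
Qed.

(** * Morphisms out of a free group *)

Lemma fg_lift_word (T : choiceType) (H : groupType) (c : T -> H) (v : seq T) :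
  fg_lift c (fg_of_word v) = \prod_(b <- v) c b.
Proof.
rewrite /fg_of_word; elim: v => [|b v IHv].
  by rewrite !big_nil /fg_lift big_nil.
by rewrite !big_cons fg_liftM fg_lift_gen IHv.
Qed.

Lemma fg_lift1 (T : choiceType) (H : groupType) (f : T -> H) : fg_lift f 1 = 1.
Proof. exact: big_nil. Qed.

Lemma fg_liftV (T : choiceType) (H : groupType) (f : T -> H) :
  {morph fg_lift f : x / x^-1}.
Proof.
by move=> x; apply: (mulgI (fg_lift f x)); rewrite -fg_liftM !mulgV fg_lift1.
Qed.

Lemma fg_lift_id (T : choiceType) (x : freeGroup T) : fg_lift (@fg_gen T) x = x.
Proof.
apply: val_inj; rewrite /= -[RHS]fg_reduce_id; last by case: x.
rewrite /fg_lift; elim: (fg_word x) => [|[a s] w IHw]; first by rewrite big_nil.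
by rewrite big_cons /= -IHw; case: s; rewrite /= fg_reduce_id //; case: (\prod_(_ <- _) _).
Qed.

Lemma fg_of_word_cat (T : choiceType) (u v : seq T) :
  fg_of_word (u ++ v) = fg_of_word u * fg_of_word v.
Proof. exact: big_cat. Qed.

Lemma fg_of_word_rcons (T : choiceType) (u : seq T) b :
  fg_of_word (rcons u b) = fg_of_word u * fg_gen b.
Proof. by rewrite -cats1 fg_of_word_cat [fg_of_word [:: b]]big_seq1. Qed.

Lemma range_subgroup (T : choiceType) (G : groupType) (f : T -> G) :
  let H := range (fg_lift f) in
  [/\ H 1, forall g, H g -> H g^-1 & forall g h, H g -> H h -> H (g * h)].
Proof.
rewrite /=; split=> [|_ [x _ <-]|_ _ [x _ <-] [y _ <-]]; first by exists 1; rewrite ?fg_lift1.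
  by exists x^-1; rewrite ?fg_liftV.
by exists (x * y); rewrite ?fg_liftM.
Qed.

(** * Permutation-valued cocycles *)

Section SymmetricGroup.
Variable W : Type.

Record sym := Sym {
  sym_fun :> W -> W;
  sym_inv : W -> W;
  sym_funK : cancel sym_fun sym_inv;
  sym_invK : cancel sym_inv sym_fun }.

HB.instance Definition _ := gen_eqMixin sym.
HB.instance Definition _ := gen_choiceMixin sym.

Lemma symP (s t : sym) : s =1 t -> s = t.
Proof.
case: s t => [f f' fK f'K] [g g' gK g'K] /= /funext eq_fg; subst g.
have eq_f' : f' = g' by apply/funext => x; rewrite -{1}[x]g'K fK.
by subst g'; congr Sym; apply: Prop_irrelevance.
Qed.

Definition sym_one : sym := @Sym id id (fun _ => erefl) (fun _ => erefl).

Definition sym_opp (s : sym) : sym := Sym (@sym_invK s) (@sym_funK s).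

(* Composition is written in diagrammatic order, so that products of letters
   act on [W] from the right. *)
Definition sym_mul (s t : sym) : sym :=
  @Sym (t \o s) (sym_inv s \o sym_inv t)
    (can_comp (@sym_funK t) (@sym_funK s))
    (can_comp (@sym_invK s) (@sym_invK t)).

Lemma sym_mulA : associative sym_mul. Proof. by move=> s t u; apply: symP. Qed.
Lemma sym_mul1 : left_id sym_one sym_mul. Proof. by move=> s; apply: symP. Qed.
Lemma sym_mulr1 : right_id sym_one sym_mul. Proof. by move=> s; apply: symP. Qed.
Lemma sym_mulV : left_inverse sym_one sym_opp sym_mul.
Proof. by move=> s; apply: symP => x /=; apply: sym_invK. Qed.
Lemma sym_mulrV : right_inverse sym_one sym_opp sym_mul.
Proof. by move=> s; apply: symP => x /=; apply: sym_funK. Qed.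

HB.instance Definition _ :=
  isGroup.Build sym sym_mulA sym_mul1 sym_mulr1 sym_mulV sym_mulrV.

Lemma symM (s t : sym) x : (s * t) x = t (s x). Proof. by []. Qed.
Lemma sym_inj (s : sym) : injective s.
Proof. exact: can_inj (@sym_funK s). Qed.

Lemma symV (s : sym) x y : s x = y -> s^-1 y = x.
Proof. by move=> <-; apply: sym_funK. Qed.

End SymmetricGroup.

(** Induction on [D]: the permutation [s] found for the tail is followed by the transposition of
    [s x] and [f x]. Injectivity of [s] and of [f] keeps [f y] off both points for [y] in the
    tail. *)
Lemma extend_partial_injection (T : eqType) (D : seq T) (f : T -> T) :
  {in D &, injective f} -> exists s : sym T, {in D, s =1 f}.
Proof.
elim: D => [|x D IHD] inj_f; first by exists 1.
have [s sP] : exists s : sym T, {in D, s =1 f}.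
  by apply: IHD => y z yD zD; apply: inj_f; rewrite inE ?yD ?zD orbT.
have [xD|xND] := boolP (x \in D).
  by exists s => y; rewrite inE => /predU1P[->|]; apply: sP.
pose tr z := if z == s x then f x else if z == f x then s x else z.
have trK : cancel tr tr.
  move=> z; rewrite /tr; have [->|zs] := eqVneq z (s x).
    by have [//|_] := eqVneq (f x) (s x); rewrite eqxx.
  have [->|zf] := eqVneq z (f x); first by rewrite eqxx.
  by rewrite (negPf zs) (negPf zf).
exists (s * Sym trK trK) => y; rewrite symM /= /tr inE => /predU1P[->|yD].
  by rewrite eqxx.
have yx : y != x by apply: contraNneq xND => <-.
rewrite (inj_eq (@sym_inj _ s)) (negPf yx) sP //.
case: eqP => // /inj_f eq_yx.
by rewrite eq_yx ?eqxx // !inE ?yD ?orbT ?eqxx in yx.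
Qed.

(* Removing an edge [x0 y0] of a forest separates its ends, so the potential on
   the component of [x0] can be translated to fit the removed edge; the
   conditions on the points [pt x j] survive since the translation fixes
   every [q j]. *)
Lemma forest_potential (T : finType) (W J : Type) (D : T -> Prop) (e : rel T)
    (g : T -> T -> sym W) (pt : T -> J -> W) (q : J -> W) (phi0 : T -> sym W) :
  symmetric e -> irreflexive e -> graph_acyclic e ->
  (forall x y, e x y -> D x) ->
  (forall x y, e x y -> g y x = (g x y)^-1) ->
  (forall x y j, e x y -> g x y (pt x j) = pt y j) ->
  (forall x j, D x -> phi0 x (pt x j) = q j) ->
  exists phi : T -> sym W,
    (forall x y, e x y -> phi x = g x y * phi y) /\
    (forall x j, D x -> phi x (pt x j) = q j).
Proof.
move=> + + + + + + phi0P.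
have [m] := ubnP #|[pred p : T * T | e p.1 p.2]|.
elim: m e => // m IHm e le_m sym_e irr_e acy_e eD gV gpt.
have [/existsP[[x0 y0] /= e0]|/existsPn e_empty] :=
  boolP [exists p : T * T, e p.1 p.2]; last first.
  by exists phi0; split=> // x y exy; have := e_empty (x, y); rewrite exy.
pose e' x y := [&& e x y, (x, y) != (x0, y0) & (x, y) != (y0, x0)].
have sub_e : subrel e' e by move=> x y /andP[].
have sym_e' : symmetric e'.
  move=> x y; rewrite /e' sym_e !xpair_eqE; congr (_ && _).
  by rewrite andbC andbC [(y == x0) && _]andbC [(y == y0) && _]andbC andbC.
have [] := IHm e'.
- rewrite ltnS in le_m; apply: leq_trans le_m; apply/proper_card/properP; split.
    by apply/fintype.subsetP => -[x y]; rewrite !inE /= => /sub_e.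
  by exists (x0, y0); rewrite !inE // /e' /= eqxx andbF.
- exact: sym_e'.
- by move=> x; apply/negP => /sub_e; rewrite irr_e.
- move=> c c_gt2 /andP[cyc uc]; apply: (acy_e c) => //.
  by rewrite /ucycle /ucycleb uc andbT (sub_cycle sub_e).
- by move=> x y /sub_e; apply: eD.
- by move=> x y /sub_e; apply: gV.
- by move=> x y j /sub_e; apply: gpt.
move=> phi [phiE phiP].
have x0D : D x0 by apply: eD e0.
have y0D : D y0 by apply: (eD _ x0); rewrite sym_e.
(* A simple path of [e'] from [x0] to [y0] would close up with the removed edge into a cycle of
   length at least three. *)
have sep : ~~ connect e' x0 y0.
  apply/negP => /connectP[p0 path_p0 last_p0].
  case: (shortenP path_p0) last_p0 => p path_p uniq_p _ last_p {p0 path_p0}.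
  apply: (acy_e (x0 :: p)).
    case: p path_p uniq_p last_p => [|z [|z' p]] //=.
      by move=> _ _ y0x0; rewrite y0x0 irr_e in e0.
    by rewrite andbT => e'z _ y0z; rewrite -y0z /e' eqxx andbF in e'z.
  rewrite /ucycle /ucycleb uniq_p andbT /= rcons_path -last_p sym_e e0 andbT.
  by apply: sub_path path_p.
(* The translation solving [phi x0 * k = g x0 y0 * phi y0], the equation of the removed edge. *)
pose k := (phi x0)^-1 * g x0 y0 * phi y0.
have kq j : k (q j) = q j.
  by rewrite /k !symM (symV (phiP _ j x0D)) gpt // phiP.
exists (fun z => if connect e' x0 z then phi z * k else phi z); split; last first.
  by move=> x j Dx; case: ifP => _; rewrite ?(symM (phi x) k) phiP.
have csym : connect_sym e' by apply: sym_connect_sym.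
move=> x y exy; have [e'xy|] := boolP (e' x y).
  rewrite (same_connect_r csym (connect1 e'xy)).
  by case: ifP => _; rewrite (phiE _ _ e'xy) ?mulgA.
rewrite /e' exy /= negb_and !negbK => /orP[] /eqP[-> ->].
  by rewrite connect0 (negPf sep) /k !mulgA mulgV mul1g.
by rewrite connect0 (negPf sep) gV // /k !mulgA mulgK mulVg mul1g.
Qed.

(** * Freeness and saturation of bifix codes in acyclic sets *)

Section AcyclicSets.
Variables (A : finType) (S : set (seq A)).
Hypothesis S_bi : biextendable S.
Hypothesis S_acyclic : forall w, S w -> graph_acyclic (ext_edge S w).

Lemma ext_edge_sym w : symmetric (ext_edge S w).
Proof. by case=> a [b|b]. Qed.

Lemma ext_edge_irr w : irreflexive (ext_edge S w).
Proof. by case. Qed.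

Lemma ext_edgeE w a b :
  ext_edge S w (inl a) (inr b) = `[< S (a :: rcons w b) >].
Proof.
have S_fact := proj1 S_bi; apply: asbool_equiv_eq; split=> [[]//|Sawb].
split=> //=; apply: S_fact Sawb _; first by rewrite -rcons_cons infix_rcons.
exact: infix_cons.
Qed.

Lemma left_extension w : S w -> exists a, S (a :: w).
Proof.
have [S_fact S_ext] := S_bi.
move=> /S_ext[[a b] /= Sawb]; exists a; apply: S_fact Sawb _.
by rewrite -rcons_cons infix_rcons.
Qed.

Lemma right_extension w : S w -> exists b, S (rcons w b).
Proof.
have [S_fact S_ext] := S_bi.
move=> /S_ext[[a b] /= Sawb]; exists b; apply: S_fact Sawb _.
exact: infix_cons.
Qed.

Lemma left_extensions n w : S w -> exists2 z, size z = n & S (z ++ w).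
Proof.
elim: n => [|n IHn] in w *; first by exists [::].
by move=> /IHn[z <- /left_extension[a Sazw]]; exists (a :: z).
Qed.

Lemma right_extensions n w : S w -> exists2 z, size z = n & S (w ++ z).
Proof.
elim: n => [|n IHn] in w *; first by exists [::]; rewrite ?cats0.
move=> /IHn[z <- /right_extension[b]]; rewrite rcons_cat => Swzb.
by exists (rcons z b); rewrite ?size_rcons.
Qed.

Section Descent.
Variables (W I : Type) (e : I -> seq A -> W).

(** A potential on the forest [G(w)] gives [alpha] on left vertices and the inverse of [beta] on
    right ones. It is normalized to send the points [e i v] of a left vertex and [e i (rcons v b)]
    of a right vertex [b] to [e i v]. *)
Lemma split_extensions w (f : A -> A -> sym W) :
  (forall a b v i, S (a :: rcons w b) -> suffix v w ->
     f a b (e i v) = e i (rcons v b)) ->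
  exists alpha beta : A -> sym W, forall a b, S (a :: rcons w b) ->
    f a b = alpha a * beta b /\
    forall v i, suffix v w ->
      alpha a (e i v) = e i v /\ beta b (e i v) = e i (rcons v b).
Proof.
move=> fP; have [Sw|NSw] := pselect (S w); last first.
  exists (fun=> 1), (fun=> 1) => a b Sawb; case: NSw.
  apply: (proj1 S_bi) Sawb _; apply: infix_trans (infix_rcons _ b) _.
  exact: infix_cons.
pose J := (I * {v : seq A | suffix v w})%type.
pose g (x y : A + A) := match x, y with
  | inl a, inr b => f a b
  | inr b, inl a => (f a b)^-1
  | _, _ => 1
  end.
pose pt (x : A + A) (j : J) :=
  if x is inr b then e j.1 (rcons (val j.2) b) else e j.1 (val j.2).
pose q (j : J) := e j.1 (val j.2).
pose D (x : A + A) := exists y, ext_edge S w x y.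
have gpt x y j : ext_edge S w x y -> g x y (pt x j) = pt y j.
  case: j => i [v vw]; case: x => [a|b]; case: y => [a'|b'] //.
    by rewrite ext_edgeE => /asboolP Sawb; apply: fP.
  rewrite ext_edge_sym ext_edgeE => /asboolP Sawb.
  by apply: symV; apply: fP.
(* A right vertex starts with the label of one of its edges, read towards the left end; an isolated
   one is outside [D], so its value [1] is arbitrary. *)
have /choice[phi0 phi0P] (x : A + A) :
    exists s : sym W, D x -> forall j, s (pt x j) = q j.
  case: x => [a|b]; first by exists 1.
  have [[[a|b'] //= e_ab]|ND] := pselect (D (inr b)); last by exists 1.
  by exists (g (inr b) (inl a)) => _ j; rewrite gpt.
have [] := @forest_potential _ W J D (ext_edge S w) g pt q phi0.
- exact: ext_edge_sym.
- exact: ext_edge_irr.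
- exact: S_acyclic.
- by move=> x y exy; exists y.
- by case=> [a|b] [a'|b'] //= _; rewrite invgK.
- by move=> x y j; apply: gpt.
- by move=> x j Dx; apply: phi0P.
move=> phi [phiE phiP].
exists (fun a => phi (inl a)), (fun b => (phi (inr b))^-1) => a b Sawb.
have e_ab : ext_edge S w (inl a) (inr b) by rewrite ext_edgeE; apply/asboolP.
split; first by rewrite (phiE _ _ e_ab) mulgK.
move=> v i vw; pose j : J := (i, exist _ v vw).
split; first by apply: (phiP (inl a) j); exists (inr b).
by apply: symV; apply: (phiP (inr b) j); exists (inl a); rewrite ext_edge_sym.
Qed.

(* A cocycle on the edges of the Rauzy graph of order [n] is cohomologous to
   one that depends on the label of the edge only: splitting it along the
   forests [G(w)] with [w] of length [n - 1] makes it a cocycle of order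
   [n - 1]. *)
Lemma cocycle_descent n (f : seq A -> A -> sym W) :
  (forall u b v i, S (rcons u b) -> size u = n -> suffix v u -> size v < n ->
     f u b (e i v) = e i (rcons v b)) ->
  exists (h : seq A -> sym W) (c : A -> sym W),
    (forall u i, S u -> size u = n -> h u (e i [::]) = e i [::]) /\
    (forall u b, S (rcons u b) -> size u = n ->
       h u * c b = f u b * h (behead (rcons u b))).
Proof.
elim: n f => [|n IHn] f fP.
  exists (fun=> 1), (fun b => f [::] b); split=> // u b _ /size0nil -> /=.
  by rewrite mul1g mulg1.
have /choice[F FP] (w : seq A) : exists ab : (A -> sym W) * (A -> sym W),
    size w = n -> forall a b, S (a :: rcons w b) ->
    f (a :: w) b = ab.1 a * ab.2 b /\
    forall v i, suffix v w ->
      ab.1 a (e i v) = e i v /\ ab.2 b (e i v) = e i (rcons v b).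
  have [sz_w|] := pselect (size w = n); last by exists (fun=> 1, fun=> 1).
  have [] := @split_extensions w (fun a b => f (a :: w) b).
    move=> a b v i Sawb vw; apply: fP => //=; first by rewrite sz_w.
      exact: suffix_trans vw (suffix_cons _ _).
    by rewrite ltnS -sz_w size_suffix.
  by move=> alpha [beta P]; exists (alpha, beta).
pose alpha u := if u is a :: w then (F w).1 a else 1.
(* Since [f (a :: w) b] is [alpha (a :: w) * (F w).2 b], twisting [f] by the coboundary of [alpha]
   leaves this cocycle, which no longer depends on [a]. *)
have [] := IHn (fun w b => (F w).2 b * alpha (rcons w b)).
  move=> w b v i Swb sz_w vw sz_v; rewrite symM.
  have [a Sawb] := left_extension Swb.
  have [_ /(_ v i vw)[_ ->]] := FP w sz_w a b Sawb.
  have [c Swbc] := right_extension Swb.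
  have : suffix (rcons v b) (rcons w b) by rewrite suffix_rcons eqxx.
  have : size (rcons w b) = n.+1 by rewrite size_rcons sz_w.
  case: (rcons w b) Swbc => // a1 w1 /= Sawc [sz_w1] vbw1.
  have [_ /(_ (rcons v b) i)[]//] := FP w1 sz_w1 a1 c Sawc.
  (* The strict bound on [size v] makes [rcons v b] a proper suffix of [rcons w b], so it is a
     suffix of [w1] and its point is fixed by [alpha]. *)
  case/suffixP: vbw1 => -[|a2 y].
    move=> /(congr1 size) /=; rewrite size_rcons sz_w1 => -[n_v].
    by rewrite n_v ltnn in sz_v.
  by move=> [_ ->]; apply: suffix_suffix.
move=> h [c [hP fE]]; exists (fun u => alpha u * h (behead u)), c; split.
  case=> // a w i Saw /= [sz_w].
  have [b Sawb] := right_extension Saw.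
  have [_ /(_ [::] i)[|-> _]] := FP w sz_w a b Sawb; first exact: suffix0s.
  by apply: hP => //; apply: (proj1 S_bi) Saw _; apply: infix_cons.
case=> // a w b /= Sawb [sz_w].
have [-> _] := FP w sz_w a b Sawb.
have Swb : S (rcons w b) by apply: (proj1 S_bi) Sawb _; apply: infix_cons.
by rewrite -mulgA fE // !mulgA.
Qed.

End Descent.

Section Saturation.
Variable X : set (seq A).
Hypotheses (X_bifix : bifix_code X) (X_S : X `<=` S).

Section Run.
Variables (G : groupType) (lab : seq A -> G).
Implicit Types (k : G) (v : seq A).

Definition run_step (s : seq A * G) (b : A) : seq A * G :=
  if `[< X (rcons s.1 b) >] then ([::], s.2 * lab (rcons s.1 b))
  else (rcons s.1 b, s.2).

Definition run k v := foldl run_step ([::], k) v.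

Lemma run_rcons k v b : run k (rcons v b) = run_step (run k v) b.
Proof. exact: foldl_rcons. Qed.

Lemma run_code k x : X x -> run k x = ([::], k * lab x).
Proof.
have [[NX0 X_pref] _] := X_bifix; case/lastP: x => [//|y b Xyb].
have run_y : run k y = (y, k).
  have : prefix y y by apply: prefix_refl.
  elim/last_ind: {1 3 4}y => // z c IHz zc_y.
  rewrite run_rcons IHz; last exact: prefix_trans (prefix_rcons _ _) zc_y.
  rewrite /run_step asboolF //= => Xzc; have := size_prefix zc_y.
  rewrite (X_pref _ _ Xzc Xyb) ?size_rcons ?ltnn //.
  exact: prefix_trans zc_y (prefix_rcons _ _).
by rewrite run_rcons run_y /run_step asboolT.
Qed.

Lemma run_split k v :
  exists2 xs : seq (seq A), (forall x, x \in xs -> X x) &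
    v = flatten xs ++ (run k v).1.
Proof.
elim/last_ind: v => [|v b [xs xsX v_def]]; first by exists [::].
rewrite run_rcons /run_step; case: asboolP => [Xpb|_] /=; last first.
  by exists xs => //; rewrite {1}v_def rcons_cat.
exists (rcons xs (rcons (run k v).1 b)).
  by move=> x; rewrite mem_rcons inE => /predU1P[->|/xsX].
by rewrite flatten_rcons cats0 {1}v_def rcons_cat.
Qed.

Lemma suffix_run k v : suffix (run k v).1 v.
Proof. by have [xs _ {2}->] := run_split k v; apply: suffix_suffix. Qed.

(** On suffixes of [u] the word component moves injectively: two of them completed by [b] to code
    words are equal, [X] being a suffix code. This map extends to a permutation of all words; the
    group component is right-multiplied by a factor depending on the word only. *)
Lemma run_transition u b : exists s : sym (seq A * G),
  forall v k, suffix v u -> s (run k v) = run k (rcons v b).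
Proof.
have X_suff := proj2 X_bifix.
pose step p := if `[< X (rcons p b) >] then [::] else rcons p b.
pose D := [seq drop i u | i <- iota 0 (size u).+1].
have DP p : p \in D -> suffix p u by case/mapP => i _ ->; apply: suffix_drop.
have [|s sP] := @extend_partial_injection _ D step.
  move=> p p' /DP pu /DP p'u; rewrite /step.
  case: asboolP => Xp; case: asboolP => Xp' //; last by move/rcons_inj=> [].
    2, 3: by move/(congr1 size); rewrite size_rcons.
  move=> _; have /rcons_inj[//] : rcons p b = rcons p' b.
  by apply: (suffix_code_uniq (u := rcons u b) X_suff); rewrite ?suffix_rcons ?eqxx.
pose tau p := if `[< X (rcons p b) >] then lab (rcons p b) else 1.
have fK : cancel (fun x : seq A * G => (s x.1, x.2 * tau x.1))
    (fun y => (sym_inv s y.1, y.2 / tau (sym_inv s y.1))).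
  by move=> [p k] /=; rewrite sym_funK mulgK.
have f'K : cancel (fun y : seq A * G => (sym_inv s y.1, y.2 / tau (sym_inv s y.1)))
    (fun x => (s x.1, x.2 * tau x.1)).
  by move=> [p k] /=; rewrite sym_invK mulgVK.
exists (Sym fK f'K) => v k vu; rewrite run_rcons /=.
have /suffixP[y u_def] := suffix_trans (suffix_run k v) vu.
have pD : (run k v).1 \in D.
  apply/mapP; exists (size y); last by rewrite u_def drop_size_cat.
  by rewrite mem_iota /= add0n ltnS u_def size_cat leq_addr.
rewrite sP // /step /tau /run_step.
by case: asboolP => // _; rewrite mulg1.
Qed.

(** The descent is applied to the transitions of the reading, after padding [v] on the left; [t] is
    the coboundary at the last [n] letters. The bound on [size v] ensures that what has been read
    before each letter is a suffix of the current context of length [n]. *)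
Lemma code_action n : exists c : A -> sym (seq A * G),
  forall v, S v -> size v <= n ->
  exists2 t : sym (seq A * G), forall k, t ([::], k) = ([::], k) &
    forall k, fg_lift c (fg_of_word v) ([::], k) = t (run k v).
Proof.
have S_fact := proj1 S_bi.
have /choice[f fP] (ub : seq A * A) : exists s : sym (seq A * G),
    forall v k, suffix v ub.1 -> s (run k v) = run k (rcons v ub.2).
  exact: run_transition.
have [|h [c [hP fE]]] := @cocycle_descent _ _ run n (fun u b => f (u, b)).
  by move=> u b v k _ _ vu _; apply: fP.
exists c => v Sv le_v; have [u sz_u Suv] := left_extensions n Sv.
exists (h (drop (size v) (u ++ v))).
  move=> k; apply: (hP _ k); last by rewrite size_drop size_cat sz_u addnK.
  by apply: S_fact Suv _; apply/suffixW/suffix_drop.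
move=> k; rewrite fg_lift_word; elim/last_ind: v le_v Suv {Sv} => [|v b IHv].
  by move=> _; rewrite cats0 drop0 big_nil => Su; rewrite (hP _ k).
rewrite size_rcons -rcons_cat => lt_v Suvb.
have uv_t : suffix (drop (size v) (u ++ v)) (u ++ v) by apply: suffix_drop.
have v_t : suffix v (drop (size v) (u ++ v)).
  rewrite drop_cat sz_u; case: ltnP => [_|]; first exact: suffix_suffix.
  by rewrite leqNgt lt_v.
rewrite -cats1 big_cat big_seq1 cats1 symM IHv; last by apply: S_fact Suvb _; apply: infix_rcons.
  rewrite -symM fE; last by rewrite size_drop size_cat sz_u addnK.
    rewrite symM fP // -drop1 -drop_rcons ?drop_drop ?add1n //.
    by rewrite size_cat leq_addl.
  apply: S_fact Suvb _; rewrite -drop_rcons; first exact/suffixW/suffix_drop.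
  by rewrite size_cat leq_addl.
exact: ltnW.
Qed.

End Run.

Variable m : nat.
Hypothesis X_size : forall x, X x -> size x <= m.

Let B : set (freeGroup A) := @fg_of_word A @` X.
Let phi : freeGroup B -> freeGroup A := fg_lift (fun b : B => val b).

(** By [m <= n], [code_action] applies to every code word, which thus translates the states [([::],
    k)] by its generator; products and inverses follow. *)
Lemma basis_action n : m <= n -> exists lab : seq A -> freeGroup B,
  exists c : A -> sym (seq A * freeGroup B),
    (forall g k, fg_lift c (phi g) ([::], k) = ([::], k * g)) /\
    forall v, S v -> size v <= n ->
    exists2 t : sym (seq A * freeGroup B), forall k, t ([::], k) = ([::], k) &
      forall k, fg_lift c (fg_of_word v) ([::], k) = t (run lab k v).
Proof.
move=> le_mn.
(* Words whose image is not in [B] get the dummy label [1]. *)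
have /choice[lab labP] (x : seq A) : exists g : freeGroup B,
    forall b : B, val b = fg_of_word x -> g = fg_gen b.
  have [[b bx]|Nb] := pselect (exists b : B, val b = fg_of_word x).
    by exists (fg_gen b) => b' b'x; congr fg_gen; apply: val_inj; rewrite bx.
  by exists 1 => b bx; case: Nb; exists b.
exists lab; have [c cP] := code_action lab n; exists c; split=> // g k.
have cB (b : B) k' : fg_lift c (val b) ([::], k') = ([::], k' * fg_gen b).
  have [x Xx xb] : B (val b) by apply: set_valP.
  have [|t t1 tP] := cP x (X_S Xx); first exact: leq_trans (X_size Xx) le_mn.
  by rewrite -xb tP run_code // t1 (labP _ b).
rewrite -{2}[g]fg_lift_id /phi /fg_lift -/(fg_lift c _).
elim: (fg_word g) k => [|[b s] w IHw] k.
  by rewrite !big_nil fg_lift1 mulg1.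
rewrite !big_cons fg_liftM symM mulgA -IHw; congr (fg_lift c _ _).
case: s => /=; first exact: cB.
by rewrite fg_liftV; apply: symV; rewrite cB mulgVK.
Qed.

(** The action recovers [g] from [phi g], as the group component of the image of [([::], 1)]. *)
Lemma bifix_code_free : injective phi.
Proof.
have [lab [c [cP _]]] := basis_action (leqnn m).
by move=> g g' eq_g; have := cP g 1; rewrite eq_g cP !mul1g => -[].
Qed.

(** As [t] fixes the states with empty word, reading [w] ends in such a state, so its code words
    leave no remainder. *)
Lemma bifix_code_saturated w :
  S w -> range phi (fg_of_word w) -> word_star X w.
Proof.
move=> Sw [g _ gw].
have [lab [c [cP runP]]] := basis_action (leq_maxl m (size w)).
have [t t1 tP] := runP w Sw (leq_maxr _ _).
have run_w : ([::], 1 * g) = run lab 1 w.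
  by apply: (@sym_inj _ t); rewrite t1 -tP -gw cP.
have [xs xsX w_def] := run_split lab 1 w.
by exists xs => //; rewrite w_def -run_w cats0.
Qed.

End Saturation.
End AcyclicSets.

(** * Counting parses *)

Section ParseCount.
Variables (A : finType) (X : set (seq A)).
Hypothesis X_bifix : bifix_code X.
Implicit Types (p q u v w : seq A).

Definition no_prefix w : bool := `[< ~ exists2 y, X y & prefix y w >].

(** The right-hand ends of the parses of [w]; each belongs to exactly one parse, so this list counts
    them. *)
Fixpoint tails w : seq (seq A) :=
  let r := if w is a :: w' then tails w' else [::] in
  if no_prefix w then w :: r else r.

Lemma no_prefix0 : no_prefix [::].
Proof.
apply/asboolP => -[y Xy]; rewrite prefixs0 => /eqP y0.
by case: X_bifix => -[]; rewrite -y0.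
Qed.

Lemma no_prefix_prefix p w : prefix p w -> no_prefix w -> no_prefix p.
Proof.
move=> pw /asboolP Nw; apply/asboolP => -[y Xy yp].
by apply: Nw; exists y => //; apply: prefix_trans pw.
Qed.

Lemma no_prefix_rcons w b :
  no_prefix (rcons w b) = no_prefix w && ~~ `[< X (rcons w b) >].
Proof.
apply/idP/andP => [Nwb|[/asboolP Nw /asboolP NX]].
  split; first exact: no_prefix_prefix (prefix_rcons _ _) Nwb.
  apply/asboolP => Xwb; move/asboolP: Nwb; apply.
  by exists (rcons w b); rewrite ?prefix_refl.
apply/asboolP => -[y Xy]; rewrite prefix_rconsE => /predU1P[y_def|yw].
  by rewrite y_def in Xy.
by apply: Nw; exists y.
Qed.

Lemma no_prefix_code w b : X (rcons w b) -> no_prefix w.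
Proof.
case: X_bifix => -[_ X_pref] _ Xwb; apply/asboolP => -[y Xy yw].
have := size_prefix yw; rewrite (X_pref _ _ Xy Xwb) ?size_rcons ?ltnn //.
exact: prefix_trans yw (prefix_rcons _ _).
Qed.

Lemma mem_tails p w : (p \in tails w) = suffix p w && no_prefix p.
Proof.
elim: w => [|a w IHw] /=.
  rewrite no_prefix0 inE suffixs0; case: eqP => // ->; exact/esym/no_prefix0.
rewrite suffix_consE; case: ifP => Nw; rewrite ?inE IHw.
  by case: eqP => //= ->; rewrite Nw.
by case: eqP => //= ->; rewrite Nw andbF.
Qed.

Lemma uniq_tails w : uniq (tails w).
Proof.
elim: w => [|a w IHw] /=; first by case: ifP.
case: ifP => //= _; rewrite IHw andbT mem_tails; apply/negP => /andP[+ _].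
by move/size_suffix; rewrite /= ltnn.
Qed.

Lemma tails_rcons_mem p w b :
  p \in tails w -> ~ X (rcons p b) -> rcons p b \in tails (rcons w b).
Proof.
rewrite !mem_tails suffix_rcons eqxx => /andP[-> Np] NX /=.
by rewrite no_prefix_rcons Np; apply/asboolP.
Qed.

Lemma mem_tails_rcons p w b :
  p \in tails (rcons w b) -> p = [::] \/ exists2 q, q \in tails w & p = rcons q b.
Proof.
rewrite mem_tails; case/lastP: p => [|q c]; first by left.
rewrite suffix_rcons => /andP[/andP[/eqP-> qw] Nq]; right; exists q => //.
by rewrite mem_tails qw; apply: no_prefix_prefix (prefix_rcons _ _) Nq.
Qed.

(** A tail [p] of [w] persists as [rcons p b] unless this is a code word, which happens at most once
    in a suffix code; the empty tail is new. *)
Lemma size_tails_rcons w b :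
  size (tails (rcons w b)) + `[< exists2 x, X x & suffix x (rcons w b) >]
  = (size (tails w)).+1.
Proof.
have X_suff := proj2 X_bifix.
have size_tails a v : size (tails (a :: v)) = no_prefix (a :: v) + size (tails v).
  by rewrite /=; case: ifP.
elim: w => [|a w IHw].
  rewrite size_tails /= !no_prefix0 /= addn1.
  rewrite (no_prefix_rcons [::]) no_prefix0 /=.
  have -> : `[< exists2 x, X x & suffix x [:: b] >] = `[< X [:: b] >].
    apply: asbool_equiv_eq; split=> [[x Xx]|Xb]; last by exists [:: b]; rewrite ?suffix_refl.
    rewrite suffix_consE => /predU1P[<- //|]; rewrite suffixs0 => /eqP x0.
    by case: X_suff; rewrite -x0.
  by case: asboolP.
rewrite rcons_cons size_tails -rcons_cons no_prefix_rcons [in RHS]size_tails.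
have -> : `[< exists2 x, X x & suffix x (rcons (a :: w) b) >] =
    `[< X (rcons (a :: w) b) >] + `[< exists2 x, X x & suffix x (rcons w b) >] :> nat.
  case: (asboolP (X _)) => [Xawb|NX].
    rewrite asboolT; last by exists (rcons (a :: w) b); rewrite ?suffix_refl.
    rewrite asboolF // => -[x Xx xwb].
    have x_def : x = rcons (a :: w) b.
      apply: suffix_code_uniq X_suff Xx Xawb _ (suffix_refl _).
      by rewrite rcons_cons; apply: suffix_trans xwb (suffix_cons _ _).
    by have := size_suffix xwb; rewrite x_def /= ltnn.
  congr nat_of_bool; apply: asbool_equiv_eq; split=> -[x Xx xwb]; exists x => //.
    by move: xwb; rewrite rcons_cons suffix_consE => /predU1P[x_def|//]; rewrite x_def in Xx.
  by rewrite rcons_cons; apply: suffix_trans xwb (suffix_cons _ _).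
rewrite -addnS -IHw; case: (asboolP (X _)) => [/no_prefix_code->|_] /=.
  by rewrite !add0n addnCA.
by rewrite andbT add0n addnA.
Qed.

Lemma size_tails_catl w z : size (tails w) <= size (tails (z ++ w)).
Proof.
by elim: z => //= a z IHz; apply: leq_trans IHz _; case: ifP => //= _.
Qed.

Lemma size_tails_catr w z : size (tails w) <= size (tails (w ++ z)).
Proof.
elim/last_ind: z => [|z b IHz]; first by rewrite cats0.
apply: leq_trans IHz _; rewrite -rcons_cat -ltnS -(size_tails_rcons _ b).
by rewrite -[X in _ <= X]addn1 leq_add2l; case: asboolP.
Qed.

(** Code words are stripped from the right: the last ones agree in a suffix code, and neither side
    stops first, as [v] or [v'] would then end in a code word. *)
Lemma parse_left_uniq v v' (xs xs' : seq (seq A)) :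
  ~ (exists2 y, X y & suffix y v) -> ~ (exists2 y, X y & suffix y v') ->
  (forall x, x \in xs -> X x) -> (forall x, x \in xs' -> X x) ->
  v ++ flatten xs = v' ++ flatten xs' -> v = v'.
Proof.
move=> Nv Nv'; elim/last_ind: xs xs' => [|xs x IHxs] xs' xsX.
  case/lastP: xs' => [|xs' x] xs'X; first by rewrite !cats0.
  rewrite cats0 flatten_rcons catA => v_def; case: Nv; exists x.
    by apply: xs'X; rewrite mem_rcons mem_head.
  by rewrite v_def suffix_suffix.
have Xx : X x by apply: xsX; rewrite mem_rcons mem_head.
case/lastP: xs' => [|xs' x'] xs'X; rewrite flatten_rcons.
  rewrite cats0 catA => v'_def; case: Nv'; exists x => //.
  by rewrite -v'_def suffix_suffix.
have Xx' : X x' by apply: xs'X; rewrite mem_rcons mem_head.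
rewrite flatten_rcons !catA => eq_w.
have eq_x : x = x'.
  apply: (suffix_code_uniq (proj2 X_bifix) Xx Xx' (suffix_suffix (v ++ flatten xs) x)).
  by rewrite eq_w; apply: suffix_suffix.
rewrite -eq_x in eq_w; move/catIs: eq_w => eq_w; apply: IHxs eq_w => y yxs.
  by apply: xsX; rewrite mem_rcons inE yxs orbT.
by apply: xs'X; rewrite mem_rcons inE yxs orbT.
Qed.

Lemma parse_left_exists w : exists v x,
  [/\ w = v ++ x, ~ (exists2 y, X y & suffix y v) & word_star X x].
Proof.
have [n] := ubnP (size w); elim: n w => // n IHn w lt_w.
have [[y Xy /suffixP[w' w_def]]|Nw] := pselect (exists2 y, X y & suffix y w).
  have [|v [x [w'_def Nv [xs xsX x_def]]]] := IHn w'.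
    rewrite ltnS in lt_w; apply: leq_trans lt_w.
    rewrite w_def size_cat -addn1 leq_add2l.
    by case: y Xy {w_def} => // /(proj1 (proj2 X_bifix)).
  exists v, (flatten (rcons xs y)); split=> //.
    by rewrite flatten_rcons catA -x_def -w'_def.
  exists (rcons xs y) => // z; rewrite mem_rcons inE => /predU1P[->//|].
  exact: xsX.
by exists w, [::]; rewrite cats0; split=> //; exists [::].
Qed.

Lemma card_parses w : parses X w #= `I_(size (tails w)).
Proof.
apply: card_eq_trans (card_uniq_seq (uniq_tails w)).
pose f (t : seq A * seq A * seq A) := t.2.
have <- : f @` parses X w = [set` tails w].
  apply/seteqP; split=> [_ [[[v x] u] [w_def Nv Nu Xx] <-]|u /=].
    by rewrite /= mem_tails w_def catA suffix_suffix; apply/asboolP.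
  rewrite mem_tails => /andP[/suffixP[w' w_def] /asboolP Nu].
  have [v [x [w'_def Nv Xx]]] := parse_left_exists w'.
  by exists (v, x, u); rewrite //= w_def w'_def -catA.
rewrite card_eq_sym; apply: inj_card_eq => -[[v x] u] [[v' x'] u'].
move=> /set_mem[w_def Nv _ [xs xsX x_def]] /set_mem[w_def' Nv' _ [xs' xsX' x_def']].
rewrite /f /= => eq_u; subst u' x x'; move: w_def'; rewrite w_def !catA.
move=> /catIs eq_vx; have eq_v := parse_left_uniq Nv Nv' xsX xsX' eq_vx.
by subst v'; move/catsI: eq_vx => ->.
Qed.

End ParseCount.

(** * Cosets and parses *)

Section Index.
Variables (A : finType) (S X : set (seq A)).
Hypotheses (S_ur : uniformly_recurrent S) (S_tree : tree_set S).
Hypothesis X_bifix : bifix_code X.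
Variable m : nat.
Hypothesis X_size : forall x, X x -> size x <= m.

Let S_bi : biextendable S := proj1 S_tree.
Let S_fact : factorial_set S := proj1 S_bi.

(* Otherwise the occurrences of [u] in a long word of [S] would start as many
   parses. *)
Lemma bounded_parses_prefix D : (forall w, S w -> size (tails X w) <= D) ->
  forall u, S u -> m < size u -> ~~ no_prefix X u.
Proof.
move=> le_D u Su lt_u; apply/negP => Nu.
have [_ _ /(_ u Su)[n _ nP]] := S_ur.
have [w Sw] : exists2 w, S w & D < size (tails X w).
  elim: D.+1 => [|k [w Sw lt_k]]; first by exists u.
  have [z sz_z Szw] := left_extensions S_bi n Sw.
  have /infixP[z1 [z2 z_def]] : infix u z.
    by apply: nP => //; apply: S_fact Szw (prefix_infix _ _).
  exists (z ++ w) => //; rewrite z_def -!catA; apply: leq_trans (size_tails_catl _ _ _).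
  (* [u] is longer than every code word, so what follows it cannot create a prefix in [X]. *)
  have : no_prefix X (u ++ z2 ++ w).
    apply/asboolP => -[x Xx xu]; move/asboolP: Nu; apply; exists x => //.
    move: xu; rewrite !prefixE takel_cat //.
    exact: leq_trans (X_size Xx) (ltnW lt_u).
  case: u lt_u {Su Nu nP z_def} => // a u _ Nauzw; rewrite /= -/cat Nauzw /= ltnS.
  by apply: leq_trans lt_k _; rewrite catA; apply: size_tails_catl.
by rewrite ltnNge le_D.
Qed.

Variable H : set (freeGroup A).
Hypotheses (H1 : H 1) (HV : forall g, H g -> H g^-1).
Hypothesis HM : forall g h, H g -> H h -> H (g * h).
Hypothesis H_code : forall x, X x -> H (fg_of_word x).
Hypothesis H_saturated : forall w, S w -> H (fg_of_word w) -> word_star X w.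

(** If [p = r ++ q], then [r] is in [S] and maps into [H], hence is a product of code words; it is
    empty because [p] has no prefix in [X]. *)
Lemma tails_coset_inj w p q : S w -> p \in tails X w -> q \in tails X w ->
  H (fg_of_word p / fg_of_word q) -> p = q.
Proof.
move=> Sw; wlog le_qp : p q / size q <= size p => [IH|].
  case/orP: (leq_total (size q) (size p)) => le pw qw Hpq; first exact: IH Hpq.
  by apply/esym; apply: IH => //; rewrite -[X in H X]invgK invgF; apply: HV.
rewrite !mem_tails // => /andP[pw /asboolP Np] /andP[qw _].
have /suffixP[r p_def] := suffix_total qw pw le_qp.
rewrite p_def fg_of_word_cat mulgK => /H_saturated[].
  apply: S_fact Sw _; apply: infix_trans (suffixW pw).
  by rewrite p_def; apply: prefix_infix.
case=> [|x xs] xsX r_def; first by rewrite r_def.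
case: Np; exists x; first by apply: xsX; apply: mem_head.
by rewrite p_def r_def /= -catA prefix_prefix.
Qed.

Let coset g : set (freeGroup A) := [set h * g | h in H].

Lemma coset_eqP g g' : coset g = coset g' <-> H (g / g').
Proof.
split=> [eq_gg'|Hgg'].
  have : coset g g by exists 1; rewrite ?mul1g.
  by rewrite eq_gg' => -[h Hh <-]; rewrite mulgK.
apply/seteqP; split=> _ [h Hh <-].
  by exists (h * (g / g')); [apply: HM|rewrite -mulgA mulgVK].
exists (h * (g / g')^-1); first by apply: HM => //; apply: HV.
by rewrite invgF -mulgA mulgVK.
Qed.

Lemma tails_card_coset w : S w ->
  (fun p => coset (fg_of_word p)) @` [set` tails X w] #= `I_(size (tails X w)).
Proof.
move=> Sw; apply: card_eq_trans (card_uniq_seq (uniq_tails X_bifix w)).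
apply: inj_card_eq => p q /set_mem pw /set_mem qw /coset_eqP.
exact: tails_coset_inj pw qw.
Qed.

Lemma index_bounds_parses d w : has_index H d -> S w -> size (tails X w) <= d.
Proof.
move=> idx_d Sw; rewrite -card_le_II -(card_le_eql (tails_card_coset Sw)).
rewrite -(card_le_eqr idx_d); apply: subset_card_le => _ [p _ <-].
by exists (fg_of_word p).
Qed.

Variables (d n0 : nat).
Hypothesis tails_long : forall u, S u -> n0 <= size u -> size (tails X u) = d.
Hypothesis prefix_long : forall u, S u -> n0 <= size u -> ~~ no_prefix X u.

(** As a set of [g], the union of the right cosets of [H] attached to the parses of [u]. *)
Let covers u g := exists2 p, p \in tails X u & H (g / fg_of_word p).

(** A tail [p] of [u] becomes [rcons p b] or, if that is a code word, the tail [[::]]. Its coset is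
    multiplied by [b] in both cases, because code words map into [H]. *)
Lemma covers_rcons u b g : S (rcons u b) -> n0 <= size u ->
  covers (rcons u b) (g * fg_gen b) <-> covers u g.
Proof.
move=> Sub le_u; split=> [[p' p'ub Hp']|[p pu Hp]].
  have [p'0|[p pu p'_def]] := mem_tails_rcons X_bifix p'ub; last first.
    exists p => //; move: Hp'.
    by rewrite p'_def fg_of_word_rcons invgM mulgA mulgK.
  have Su : S u by apply: S_fact Sub (infix_rcons _ _).
  (* Both words have [d] parses, so the count forces a code word to end at [b]; it accounts for the
     empty tail. *)
  have := size_tails_rcons X_bifix u b.
  rewrite !tails_long ?size_rcons // 1?leqW // -addn1 => /addnI.
  case: asboolP => // -[x Xx xub] _; case/lastP: x Xx xub => [X0|p c].
    by case: (proj1 X_bifix).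
  rewrite suffix_rcons => Xx /andP[/eqP eq_c pu]; subst c.
  exists p; first by rewrite mem_tails // pu; apply: no_prefix_code Xx.
  have := HM Hp' (HV (H_code Xx)).
  by rewrite p'0 [fg_of_word [::]]big_nil invg1 mulg1 fg_of_word_rcons invgM mulgA mulgK.
have [Xpb|NX] := pselect (X (rcons p b)).
  exists [::]; first by rewrite mem_tails // suffix0s no_prefix0.
  rewrite [fg_of_word [::]]big_nil invg1 mulg1.
  by have := HM Hp (H_code Xpb); rewrite fg_of_word_rcons mulgA mulgVK.
exists (rcons p b); first exact: tails_rcons_mem.
by rewrite fg_of_word_rcons invgM mulgA mulgK.
Qed.

(** A suffix longer than [w] has length at least [n0], hence a prefix in [X], and is no tail. *)
Lemma tails_cat_long z w : S (z ++ w) -> n0 <= size w ->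
  tails X (z ++ w) = tails X w.
Proof.
move=> + le_w; elim: z => [//|a z IHz] Sazw /=.
rewrite -/cat (negPf (prefix_long Sazw _)) ?IHz //=.
  by apply: S_fact Sazw _; apply: infix_cons.
by rewrite size_cat leqW // (leq_trans le_w) // leq_addl.
Qed.

(* Connectedness of the extension graphs propagates the independence of the
   left context from longer to shorter right contexts. *)
Lemma covers_left_context j w z z' g : S w -> n0 <= size w + j ->
  S (z ++ w) -> S (z' ++ w) -> n0 <= size (z ++ w) -> n0 <= size (z' ++ w) ->
  covers (z ++ w) g -> covers (z' ++ w) g.
Proof.
elim: j => [|j IHj] in w z z' g *.
  rewrite addn0 => _ le_w Szw Sz'w _ _.
  by rewrite /covers !tails_cat_long.
move=> Sw le_wj Szw Sz'w le_zw le_z'w.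
have [le_w|lt_w] := leqP n0 (size w); first by rewrite /covers !tails_cat_long.
case/lastP: z => [|z a] in Szw le_zw *; first by rewrite leqNgt lt_w in le_zw.
case/lastP: z' => [|z' a'] in Sz'w le_z'w *; first by rewrite leqNgt lt_w in le_z'w.
rewrite !cat_rcons in Szw Sz'w le_zw le_z'w *.
have Saw : S (a :: w) by apply: S_fact Szw (suffix_infix _ _).
have Sa'w : S (a' :: w) by apply: S_fact Sz'w (suffix_infix _ _).
have le_wj1 (v : seq A) : size v = (size w).+1 -> n0 <= size v + j.
  by move=> ->; rewrite addSnnS.
(* At a vertex, [P] asks for a long word of [S] ending in the corresponding one-letter extension of
   [w] and covering [g], or [g * fg_gen b] at a right vertex [b]. *)
pose P (x : A + A) := match x with
  | inl a => exists y, [/\ S (y ++ a :: w), n0 <= size (y ++ a :: w) &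
                           covers (y ++ a :: w) g]
  | inr b => exists y, [/\ S (y ++ rcons w b), n0 <= size (y ++ rcons w b) &
                           covers (y ++ rcons w b) (g * fg_gen b)]
  end.
(* The long word [y ++ c :: w], extended by [b], serves both ends: [covers_rcons] crosses the letter
   [b], and the induction hypothesis changes the left context of [c :: w] or of [rcons w b]. *)
have P_edge c b : S (c :: rcons w b) -> P (inl c) <-> P (inr b).
  move=> Scwb; have [y sz_y Sycwb] := left_extensions S_bi n0 Scwb.
  have Scw : S (c :: w).
    by apply: S_fact Scwb _; rewrite -rcons_cons; apply: infix_rcons.
  have Swb : S (rcons w b) by apply: S_fact Scwb _; apply: infix_cons.
  have Sycw : S (y ++ c :: w).
    by apply: S_fact Sycwb _; rewrite -rcons_cons -rcons_cat; apply: infix_rcons.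
  have le_y : n0 <= size (y ++ c :: w) by rewrite size_cat sz_y leq_addr.
  have le_yb : n0 <= size (rcons y c ++ rcons w b).
    by rewrite size_cat size_rcons sz_y (leq_trans (leqnSn n0)) // leq_addr.
  have eq_y : rcons (y ++ c :: w) b = rcons y c ++ rcons w b.
    by rewrite cat_rcons -rcons_cons rcons_cat.
  have Sycwb' : S (rcons y c ++ rcons w b) by rewrite cat_rcons.
  split=> [[y' [Sy' le_y' cov]]|[y' [Sy' le_y' cov]]].
    exists (rcons y c); split=> //; rewrite -eq_y; apply/covers_rcons => //.
      by rewrite eq_y.
    by apply: IHj cov => //; apply: le_wj1.
  exists y; split=> //; apply/(@covers_rcons _ b) => //; rewrite eq_y //.
  by apply: IHj cov => //; apply: le_wj1; rewrite size_rcons.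
have P_step x y : ext_edge S w x y -> P x -> P y.
  case: x y => [c|b] [c'|b'] //; last rewrite ext_edge_sym.
    by rewrite ext_edgeE // => /asboolP Scwb /(P_edge _ _ Scwb).
  by rewrite ext_edgeE // => /asboolP Scwb /(P_edge _ _ Scwb).
have P_connect x y : connect (ext_edge S w) x y -> P x -> P y.
  case/connectP=> s + ->; elim: s x => //= y' s IHs x /andP[exy' path_s] Px.
  exact: IHs path_s (P_step _ _ exy' Px).
move=> cov; have [conn _] := (proj2 S_tree) w Sw.
have [y [Sy le_y cov']] : P (inl a').
  apply: (P_connect (inl a)); last by exists z.
  by apply: conn; left; [exists a|exists a'].
by apply: IHj cov' => //; apply: le_wj1.
Qed.

Hypothesis S_letters : forall a, S [:: a].

(** With an empty right context, [covers] does not depend on the long word; [covers_rcons] then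
    makes it invariant under right multiplication by each generator and its inverse, and it contains
    [1]. *)
Lemma covers_all u g : S u -> n0 <= size u -> covers u g.
Proof.
move=> Su le_u.
have S0 : S [::] by apply: S_fact Su (infix0s _).
have move_context v v' g' : S v -> S v' -> n0 <= size v -> n0 <= size v' ->
    covers v g' -> covers v' g'.
  move=> Sv Sv' le_v le_v'; have := @covers_left_context n0 [::] v v' g' S0.
  by rewrite !cats0 add0n; apply.
have cov_gen b g' : covers u (g' * fg_gen b) <-> covers u g'.
  have [z sz_z] := left_extensions S_bi n0 (S_letters b).
  rewrite cats1 => Szb.
  have Sz : S z by apply: S_fact Szb (infix_rcons _ _).
  have le_z : n0 <= size z by rewrite sz_z.
  have le_zb : n0 <= size (rcons z b) by rewrite size_rcons leqW.
  split=> cov.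
    apply: (move_context z) => //; apply/(covers_rcons _ Szb) => //.
    exact: move_context cov.
  apply: (move_context (rcons z b)) => //; apply/(covers_rcons _ Szb) => //.
  exact: move_context cov.
rewrite -[g]fg_lift_id /fg_lift -[X in covers u X]mul1g.
have cov_mul (w : seq (A * bool)) g' : covers u g' ->
    covers u (g' * \prod_(l <- w) if l.2 then fg_gen l.1 else (fg_gen l.1)^-1).
  elim: w g' => [|[b s] w IHw] g' cov; first by rewrite big_nil mulg1.
  rewrite big_cons mulgA; apply: IHw; case: s => /=; first exact/cov_gen.
  by apply/(cov_gen b); rewrite mulgVK.
apply: cov_mul; exists [::]; first by rewrite mem_tails // suffix0s no_prefix0.
by rewrite [fg_of_word [::]]big_nil mulgV.
Qed.

Lemma index_eq_degree : S [::] -> has_index H d.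
Proof.
move=> S0; have [u sz_u] := right_extensions S_bi n0 S0; rewrite cat0s => Su.
have le_u : n0 <= size u by rewrite sz_u.
have := tails_card_coset Su; rewrite (tails_long Su le_u); congr (is_true (_ #= _)).
apply/seteqP; split=> [_ [p _ <-]|_ [g _ <-]]; first by exists (fg_of_word p).
have [p pu Hp] := covers_all g Su le_u.
by exists p => //; apply/esym/coset_eqP.
Qed.

End Index.

(* Maximality, degree and index *)
Local Close Scope group_scope.

Theorem theorem4p4 (A : finType) (hA : 0 < #|A|) (S : set (seq A))
    (hur : uniformly_recurrent S) (htree : tree_set S)
    (hAS : forall a : A, S [:: a])
    (X : set (seq A)) (hfin : finite_set X) (hbifix : bifix_code X)
    (hXS : X `<=` S) (d : nat) (hd : 1 <= d) :
  (maximal_bifix_code S X /\ has_degree S X d) <->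
  (exists H : set (freeGroup A),
     [/\ is_subgroup H, has_index H d & is_basis H (@fg_of_word A @` X)]).
Proof.
have [S_bi S_trees] := htree; have S_fact := proj1 S_bi.
have S0 : S [::].
  by case/card_gt0P: hA => a _; apply: S_fact (hAS a) (infix0s _).
have S_acyclic w : S w -> graph_acyclic (ext_edge S w) by case/S_trees.
have [m X_size] : exists m, forall x, X x -> size x <= m.
  have [s ->] := (finite_seqP _).1 hfin; exists (\max_(x <- s) size x) => x /= xs.
  by apply: (@leq_bigmax_seq _ s xpredT size).
pose B := @fg_of_word A @` X.
pose phi : freeGroup B -> freeGroup A := fg_lift (fun b : B => val b).
have [H1 HV HM] : [/\ range phi 1%g, forall g, range phi g -> range phi g^-1%g &
    forall g h, range phi g -> range phi h -> range phi (g * h)%g].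
  exact: range_subgroup.
have H_code x : X x -> range phi (fg_of_word x).
  move=> Xx; have Bx : fg_of_word x \in B by apply/mem_set; exists x.
  by exists (fg_gen (SigSub Bx)); rewrite // /phi fg_lift_gen.
have H_sat : forall w, S w -> range phi (fg_of_word w) -> word_star X w.
  exact: bifix_code_saturated X_size.
have degree_index d' : has_degree S X d' -> has_index (range phi) d'.
  move=> [[w0 Sw0 card_w0] le_d'].
  have tails_le w : S w -> size (tails X w) <= d'.
    by move/le_d'; rewrite (card_le_eql (card_parses hbifix w)) card_le_II.
  have tails_w0 : size (tails X w0) = d'.
    by apply/card_eq_II; rewrite -(card_eql (card_parses hbifix w0)).
  have [_ _ /(_ w0 Sw0)[n n_gt0 nP]] := hur.
  (* Length [n] forces an occurrence of [w0], hence at least [d'] parses; [m.+1] exceeds the length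
     of every code word. *)
  apply: (index_eq_degree htree hbifix H1 HV HM H_code H_sat
    (n0 := maxn n m.+1)) => //.
    move=> u Su; rewrite geq_max => /andP[le_n _].
    apply/eqP; rewrite eqn_leq tails_le //=.
    have /infixP[y [z t_def]] : infix w0 (take n u).
      apply: nP; last by rewrite size_takel.
      by apply: S_fact Su (prefixW (prefix_take _ _)).
    rewrite -(cat_take_drop n u) t_def -!catA -tails_w0.
    by apply: leq_trans (size_tails_catl _ _ _); apply: size_tails_catr.
  move=> u Su; rewrite geq_max => /andP[_ lt_m].
  exact: bounded_parses_prefix tails_le _ Su lt_m.
split=> [[_ deg_d]|[H [_ idx_d [_ H_def]]]].
  exists (range phi); split; first 2 last.
  - by split=> //; exact: (bifix_code_free S_bi S_acyclic hbifix hXS X_size).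
  - split; first exact: mem_set.
    move=> g h /set_mem Hg /set_mem Hh; apply: mem_set.
    by apply: HM => //; apply: HV.
  - exact: degree_index.
rewrite -{H}H_def -/phi in idx_d.
have tails_le w : S w -> size (tails X w) <= d.
  exact: (index_bounds_parses htree hbifix H1 HV HM H_sat idx_d).
have X_prefix u : S u -> m < size u -> exists2 x, X x & prefix x u.
  move=> Su lt_m; apply: contrapT => Nu.
  have /negP := bounded_parses_prefix hur htree X_size tails_le Su lt_m.
  by apply; apply/asboolP.
(* Parse counts are bounded by [d], so their maximum [d'] is the degree; [degree_index] then
   identifies it with the index [d]. *)
have [d' deg_d'] : exists d', has_degree S X d'.
  have ex_d : exists k, `[< exists2 w, S w & size (tails X w) = k >].
    by exists (size (tails X [::])); apply/asboolP; exists [::].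
  have le_d k : `[< exists2 w, S w & size (tails X w) = k >] -> k <= d.
    by move/asboolP => [w Sw <-]; apply: tails_le.
  case: (ex_maxnP ex_d le_d) => d' /asboolP[w Sw w_d'] d'_max.
  exists d'; split; first by exists w; rewrite // -w_d'; apply: card_parses.
  move=> v Sv; rewrite (card_le_eql (card_parses hbifix v)) card_le_II.
  by apply: d'_max; apply/asboolP; exists v.
have -> : d = d'.
  by apply/card_eq_II; rewrite -(card_eql idx_d); apply: degree_index.
split=> //; split=> // Y [[Y0 Y_pref] _] YS XY.
apply/seteqP; split=> // y Yy.
(* Extended on the right beyond length [m], [y] gains a prefix [x] in [X]; [x] and [y] are prefixes
   of one word and lie in the prefix code [Y], so they coincide. *)
have [z sz_z Syz] := right_extensions S_bi m.+1 (YS y Yy).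
have [|x Xx xyz] := X_prefix _ Syz; first by rewrite size_cat sz_z leq_addl.
have Yx := XY x Xx.
suff -> : y = x by [].
have yyz : prefix y (y ++ z) by apply: prefix_prefix.
rewrite -suffix_rev in xyz; rewrite -suffix_rev in yyz.
case/orP: (leq_total (size x) (size y)) => le.
  by apply/esym; apply: Y_pref => //; rewrite -suffix_rev (suffix_total xyz yyz) ?size_rev.
by apply: Y_pref => //; rewrite -suffix_rev (suffix_total yyz xyz) ?size_rev.
Qed.
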